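(* Let $\mathcal{P}=(|K|,V_{\mathcal{P}})$ be a polyhedral model and $x_1,x_2\in|K|$. Then $x_1\equiv_\eta x_2$ (they satisfy the same $\mathrm{SLCS}_\eta$ formulas in $\mathcal{P}$) if and only if $x_1$ and $x_2$ are weakly simplicial bisimilar.
   Context: $K$ is a simplicial complex in $\mathbb{R}^m$ (a finite set of simplexes closed under faces, pairwise intersecting in common faces), $|K|$ the union of its simplexes with the Euclidean subspace topology; the relative interiors (cells) of its simplexes partition $|K|$. A polyhedral model is $\mathcal{P}=(|K|,V_{\mathcal{P}})$ with $V_{\mathcal{P}}:PL\to2^{|K|}$ ($PL$ a set of proposition letters), each $V_{\mathcal{P}}(p)$ a union of cells. A topological path from $x$ is a continuous $\pi:[0,1]\to|K|$ with $\pi(0)=x$. $\mathrm{SLCS}_\eta$ formulas: $\Phi::=p\mid\neg\Phi\mid\Phi_1\wedge\Phi_2\mid\eta(\Phi_1,\Phi_2)$; semantics: $x\models p$ iff $x\in V_{\mathcal{P}}(p)$, Boolean connectives as usual, $x\models\eta(\Phi_1,\Phi_2)$ iff there is a topological path $\pi$ from $x$ with $\pi(1)\models\Phi_2$ and $\pi(r)\models\Phi_1$ for all $r\in[0,1)$. A symmetric relation $Z\subseteq|K|\times|K|$ is a weak simplicial bisimulation if whenever $Z(x_1,x_2)$: (1) $\{p: x_1\in V_{\mathcal{P}}(p)\}=\{p:x_2\in V_{\mathcal{P}}(p)\}$; (2) for each topological path $\pi_1$ from $x_1$ there is a topological path $\pi_2$ from $x_2$ such that $Z(\pi_1(1),\pi_2(1))$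 and for every $r_2\in[0,1)$ there is $r_1\in[0,1)$ with $Z(\pi_1(r_1),\pi_2(r_2))$. $x_1,x_2$ are weakly simplicial bisimilar if $Z(x_1,x_2)$ for some weak simplicial bisimulation $Z$. *)

(* Defs.v *)
From HB Require Import structures.
From mathcomp Require Import all_boot all_order all_algebra.
From mathcomp Require Import finmap.
From mathcomp Require Import all_classical all_reals all_analysis.

Set Implicit Arguments.
Unset Strict Implicit.
Unset Printing Implicit Defensive.

Import Order.TTheory GRing.Theory Num.Theory.
Import numFieldNormedType.Exports.

Local Open Scope classical_set_scope.
Local Open Scope ring_scope.

                                                                 
Definition affinely_independent (R : realType) (m : nat)
    (s : {fset 'rV[R]_m}) : Prop :=
  forall a : 'rV[R]_m -> R,
    \sum_(v <- s) a v = 0 -> \sum_(v <- s) a v *: v = 0 ->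
    forall v, v \in s -> a v = 0.

Definition is_simplex (R : realType) (m : nat) (s : {fset 'rV[R]_m}) : Prop :=
  s != fset0 /\ affinely_independent s.

Definition hull (R : realType) (m : nat) (s : {fset 'rV[R]_m}) :
    set 'rV[R]_m :=
  [set x | exists a : 'rV[R]_m -> R,
     [/\ forall v, v \in s -> 0 <= a v,
         \sum_(v <- s) a v = 1 &
         x = \sum_(v <- s) a v *: v]].

                                                                      
Definition cell (R : realType) (m : nat) (s : {fset 'rV[R]_m}) :
    set 'rV[R]_m :=
  [set x | exists a : 'rV[R]_m -> R,
     [/\ forall v, v \in s -> 0 < a v,
         \sum_(v <- s) a v = 1 &
         x = \sum_(v <- s) a v *: v]].

Definition is_face (R : realType) (m : nat) (t s : {fset 'rV[R]_m}) : Prop :=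
  t != fset0 /\ (t `<=` s)%fset.

Record simplicial_complex (R : realType) (m : nat) := SimplicialComplex {
  simplexes : {fset {fset 'rV[R]_m}};
  simplexes_simplex : forall s, s \in simplexes -> is_simplex s;
  simplexes_face : forall s t,
    s \in simplexes -> is_face t s -> t \in simplexes;
  simplexes_meet : forall s t,
    s \in simplexes -> t \in simplexes -> hull s `&` hull t !=set0 ->
    exists u, [/\ is_face u s, is_face u t & hull s `&` hull t = hull u]
}.

Definition polyhedron (R : realType) (m : nat) (K : simplicial_complex R m) :
    set 'rV[R]_m :=
  \bigcup_(s in [set` simplexes K]) hull s.

Record polyhedral_model (R : realType) (m : nat) (PL : Type) :=
  PolyhedralModel {
  complex : simplicial_complex R m;
  valuation : PL -> set 'rV[R]_m;
  valuation_cells : forall p, exists C : set {fset 'rV[R]_m},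
    C `<=` [set` simplexes complex] /\ valuation p = \bigcup_(s in C) cell s
}.

Definition carrier (R : realType) (m : nat) (PL : Type)
    (P : polyhedral_model R m PL) : set 'rV[R]_m := polyhedron (complex P).

                                                                          
                                                                             
                    
Definition path_from (R : realType) (m : nat) (PL : Type)
    (P : polyhedral_model R m PL) (x : 'rV[R]_m) (pi : R -> 'rV[R]_m) : Prop :=
  [/\ {within `[0, 1], continuous pi},
      forall r, r \in `[0, 1] -> carrier P (pi r) &
      pi 0 = x].

Inductive formula (PL : Type) : Type :=
| Prop_letter of PL
| Neg of formula PL
| Conj of formula PL & formula PL
| Eta of formula PL & formula PL.

Fixpoint sat (R : realType) (m : nat) (PL : Type) (P : polyhedral_model R m PL)
    (phi : formula PL) (x : 'rV[R]_m) : Prop :=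
  match phi with
  | Prop_letter p => valuation P p x
  | Neg phi1 => ~ sat P phi1 x
  | Conj phi1 phi2 => sat P phi1 x /\ sat P phi2 x
  | Eta phi1 phi2 => exists pi : R -> 'rV[R]_m,
      [/\ path_from P x pi,
          sat P phi2 (pi 1) &
          forall r, r \in `[0, 1[ -> sat P phi1 (pi r)]
  end.

Definition eta_equivalent (R : realType) (m : nat) (PL : Type)
    (P : polyhedral_model R m PL) (x1 x2 : 'rV[R]_m) : Prop :=
  forall phi : formula PL, sat P phi x1 <-> sat P phi x2.

Definition weak_simplicial_bisimulation (R : realType) (m : nat) (PL : Type)
    (P : polyhedral_model R m PL) (Z : 'rV[R]_m -> 'rV[R]_m -> Prop) : Prop :=
  [/\ forall x1 x2, Z x1 x2 -> carrier P x1 /\ carrier P x2,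
      forall x1 x2, Z x1 x2 -> Z x2 x1 &
      forall x1 x2, Z x1 x2 ->
        [set p | valuation P p x1] = [set p | valuation P p x2] /\
        (forall pi1, path_from P x1 pi1 ->
          exists pi2, [/\ path_from P x2 pi2,
            Z (pi1 1) (pi2 1) &
            forall r2, r2 \in `[0, 1[ ->
              exists2 r1, r1 \in `[0, 1[ & Z (pi1 r1) (pi2 r2)])].

Definition weakly_simplicial_bisimilar (R : realType) (m : nat) (PL : Type)
    (P : polyhedral_model R m PL) (x1 x2 : 'rV[R]_m) : Prop :=
  exists Z, weak_simplicial_bisimulation P Z /\ Z x1 x2.

(* Main.v *)
(**
Two points x, y of the same cell satisfy the same formulas: a path witnessing
eta(Phi1, Phi2) at x is prefixed by the segment from y to x, which stays in the
cell, where Phi1 holds by induction because it holds at x. Cells are finitely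
many, so there are finitely many eta-equivalence classes, and every union of
classes is defined by a formula. For a path pi from x1 and x2 equivalent to x1,
let Phi define the union of the classes met by pi on [0, 1[ and Psi the class
of pi(1); then x1, hence x2, satisfies eta(Phi, Psi), and the witness at x2 is
the path required of a bisimulation.
*)
Require Import Defs.
From mathcomp Require Import all_boot all_order all_algebra finmap.
From mathcomp Require Import all_classical all_reals all_analysis.
From mathcomp Require Import lra.

Set Implicit Arguments.
Unset Strict Implicit.
Unset Printing Implicit Defensive.

Import Order.TTheory GRing.Theory Num.Theory.
Import numFieldNormedType.Exports.

Local Open Scope classical_set_scope.
Local Open Scope ring_scope.

(** Paths are continuous only within the unit interval; precomposing with a map clamped to it gives
    a globally continuous function, which is easier to glue. *)
Lemma continuous_comp_into (T U V : topologicalType) (A : set U)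
    (g : T -> U) (f : U -> V) :
  continuous g -> (forall t, A (g t)) -> {within A, continuous f} ->
  continuous (f \o g).
Proof.
move=> cg gA cf t W /(cf (g t)) /=; rewrite nbhs_simpl /= => Wgt.
have Wt : within A (nbhs (g t)) (f @^-1` W).
  by rewrite (nbhs_subspace_in (gA t)).
have := cg t _ Wt; rewrite !nbhs_simpl /=; apply: filterS => u; exact.
Qed.

(** * Barycentric coordinates, cells, and gluing a segment to a path *)

Section Simplexes.
Variables (R : realType) (m : nat).
Implicit Types (s t : {fset 'rV[R]_m}) (x y : 'rV[R]_m).

Lemma cell_hull s : cell s `<=` hull s.
Proof. by move=> x [a [a0 a1 ->]]; exists a; split => // v /a0 /ltW. Qed.

Lemma cell_segment s x y (t : R) : cell s x -> cell s y -> 0 <= t <= 1 ->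
  cell s (x + t *: (y - x)).
Proof.
move=> [a [a0 a1 ->]] [b [b0 b1 ->]] /andP[t0 t1].
exists (fun v => a v + t * (b v - a v)); split => [v vs| |].
- have := a0 v vs; have := b0 v vs => /= bv av.
  (* The coordinate is [(1 - t) * a v + t * b v], whose second term is strictly positive unless
     [t = 0]. *)
  have [->|tn0] := eqVneq t 0; first by rewrite mul0r addr0.
  have : 0 < t * b v by rewrite mulr_gt0// lt_neqAle eq_sym tn0.
  have : 0 <= (1 - t) * a v by rewrite mulr_ge0 ?subr_ge0 // ltW.
  lra.
- by rewrite big_split /= -mulr_sumr sumrB a1 b1 subrr mulr0 addr0.
- rewrite -sumrB scaler_sumr -big_split /=; apply: eq_bigr => v _.
  by rewrite scalerDl scalerBr mulrBr scalerBl !scalerA.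
Qed.

(** Coordinates over [u], extended by zero to [s], must agree with the positive ones by affine
    independence, so no vertex of [s] lies outside [u]. *)
Lemma cell_meet_hull_face s u x : affinely_independent s -> (u `<=` s)%fset ->
  cell s x -> hull u x -> u = s.
Proof.
move=> indep us [a [a0 a1 xa]] [b [b0 b1 xb]].
pose b' v := if v \in u then b v else 0.
have b'1 : \sum_(v <- s) b' v = 1.
  rewrite -b1 -(big_fset_incl _ us); last first.
    by move=> v _ /negbTE; rewrite /b' => ->.
  by rewrite big_seq [RHS]big_seq; apply: eq_bigr => v vu; rewrite /b' vu.
have xb' : x = \sum_(v <- s) b' v *: v.
  rewrite xb -(big_fset_incl _ us); last first.
    by move=> v _ /negbTE; rewrite /b' => ->; rewrite scale0r.
  by rewrite big_seq [RHS]big_seq; apply: eq_bigr => v vu; rewrite /b' vu.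
have ab : forall v, v \in s -> a v - b' v = 0.
  apply: indep; first by rewrite sumrB a1 b'1 subrr.
  rewrite (eq_bigr _ (fun v _ => scalerBl (a v) (b' v) v)) sumrB -xa -xb'.
  exact: subrr.
apply/eqP; rewrite eqEfsubset us; apply/fsubsetP => v vs.
have := ab v vs; rewrite /b'; case: ifP => // _ /eqP; rewrite subr0.
by rewrite gt_eqF ?a0.
Qed.

(** The hulls meet in the hull of a common face; it contains [x], which is in both cells, so this
    face is all of [s] and all of [t]. *)
Lemma cell_disjoint (K : simplicial_complex R m) s t x :
  s \in simplexes K -> t \in simplexes K -> cell s x -> cell t x -> s = t.
Proof.
move=> sK tK sx tx.
have [|u [[_ us] [_ ut] stu]] := simplexes_meet sK tK.
  by exists x; split; exact: cell_hull.
have ux : hull u x by rewrite -stu; split; exact: cell_hull.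
have [_ si] := simplexes_simplex sK; have [_ ti] := simplexes_simplex tK.
by rewrite -(cell_meet_hull_face si us sx ux) (cell_meet_hull_face ti ut tx ux).
Qed.

(** The vertices with positive coordinate at [x] span the required face. *)
Lemma polyhedron_cell (K : simplicial_complex R m) x :
  polyhedron K x -> exists2 s, s \in simplexes K & cell s x.
Proof.
move=> [s /= sK [a [a0 a1 xa]]].
pose u := [fset v in s | 0 < a v]%fset.
have us : (u `<=` s)%fset by exact: fset_sub.
have au v : v \in s -> v \notin u -> a v = 0.
  move=> vs; rewrite !inE /= vs /= -leNgt => av.
  by apply/eqP; rewrite eq_le av a0.
have u1 : \sum_(v <- u) a v = 1 by rewrite (big_fset_incl _ us).
exists u.
  apply: (simplexes_face sK); split => //; apply/eqP => u0.
  by move: u1 => /eqP; rewrite u0 big_seq_fset0 eq_sym oner_eq0.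
exists a; split => //; first by move=> v; rewrite !inE /= => /andP[].
by rewrite xa (big_fset_incl _ us) // => v vs /au ->//; rewrite scale0r.
Qed.

Lemma cell_carrier (PL : Type) (P : polyhedral_model R m PL) s :
  s \in simplexes (complex P) -> cell s `<=` carrier P.
Proof. by move=> sK x /cell_hull ?; exists s. Qed.

(** The new path runs from [y] to [pi 0] up to time 1/2, with [t] decreasing from 1 to 0, then
    follows [pi] at double speed. *)
Lemma prepend_segment (pi : R -> 'rV[R]_m) y :
  {within `[0, 1], continuous pi} ->
  exists pi' : R -> 'rV[R]_m,
    [/\ continuous pi', pi' 0 = y, pi' 1 = pi 1 &
        forall r, r \in `[0, 1[ ->
          (exists2 t, 0 <= t <= 1 & pi' r = pi 0 + t *: (y - pi 0)) \/
          (exists2 q, q \in `[0, 1[ & pi' r = pi q)].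
Proof.
move=> cpi.
(* The glued path is written as a sum of two everywhere continuous terms: with
   [g] and [h] clamped, the second one vanishes exactly when the first one
   starts to move. *)
pose g (r : R) : R := Num.max 0 (Num.min 1 (2 * r - 1)).
pose h (r : R) : R := Num.max 0 (1 - 2 * r).
have c2 : continuous (fun r : R => 2 * r).
  by move=> r; apply: cvgM; [exact: cvg_cst | exact: cvg_id].
have cg : continuous g.
  apply: max_fun_continuous; first by move=> ?; exact: cvg_cst.
  apply: min_fun_continuous; first by move=> ?; exact: cvg_cst.
  by move=> r; apply: cvgB; [exact: c2 | exact: cvg_cst].
have ch : continuous h.
  apply: max_fun_continuous; first by move=> ?; exact: cvg_cst.
  by move=> r; apply: cvgB; [exact: cvg_cst | exact: c2].
have g01 r : `[0, 1]%classic (g r).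
  rewrite /= in_itv /= /g le_max lexx /= ge_max ler01 /=.
  by rewrite ge_min lexx.
have cpg := continuous_comp_into cg g01 cpi.
have gl r : r <= 2^-1 -> g r = 0.
  by move=> r2; rewrite /g; apply/max_idPl; rewrite ge_min; apply/orP; right; lra.
have gr r : 2^-1 <= r <= 1 -> g r = 2 * r - 1.
  move=> r2; rewrite /g (min_idPr _); last by lra.
  by apply/max_idPr; lra.
have hl r : r <= 2^-1 -> h r = 1 - 2 * r.
  by move=> r2; apply/max_idPr; lra.
have hr r : 2^-1 <= r -> h r = 0.
  by move=> r2; apply/max_idPl; lra.
exists (fun r => pi (g r) + h r *: (y - pi 0)); split.
- move=> r; apply: cvgD; first exact: cpg.
  by apply: cvgZr_tmp; exact: ch.
- by rewrite gl ?hl ?invr_ge0 ?ler0n // mulr0 subr0 scale1r subrKC.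
- have le2 : 2^-1 <= 1 :> R by lra.
  by rewrite gr ?hr ?le2 ?lexx // scale0r addr0 mulr1 [2 - 1]addrK.
- move=> r; rewrite in_itv /= => r01; case: (lerP r 2^-1) => r2.
    by left; exists (h r); rewrite ?gl ?hl //; lra.
  right; exists (2 * r - 1); first by rewrite in_itv /=; lra.
  by rewrite gr ?hr ?scale0r ?addr0 //; lra.
Qed.

End Simplexes.

(** * Invariance of formulas on cells, definability, and bisimulations *)

Section Logic.
Variables (R : realType) (m : nat) (PL : Type) (P : polyhedral_model R m PL).
Implicit Types (x y : 'rV[R]_m) (phi : formula PL).

Lemma path_prepend_cell s x y pi :
  s \in simplexes (complex P) -> cell s x -> cell s y -> path_from P x pi ->
  exists pi', [/\ path_from P y pi', pi' 1 = pi 1 &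
    forall r, r \in `[0, 1[ ->
      cell s (pi' r) \/ (exists2 q, q \in `[0, 1[ & pi' r = pi q)].
Proof.
move=> sK sx sy [cpi pi_in pi0].
have [pi' [cpi' pi'0 pi'1 H]] := prepend_segment y cpi.
have pi'E r : r \in `[0, 1[ ->
    cell s (pi' r) \/ (exists2 q, q \in `[0, 1[ & pi' r = pi q).
  move=> /H[[t t01 ->]|]; last by right.
  by left; rewrite pi0; exact: cell_segment.
exists pi'; split => //; split => //; first exact: continuous_subspaceT.
move=> r; rewrite in_itv /= => /andP[r0]; rewrite le_eqVlt => /predU1P[->|r1].
  by rewrite pi'1; apply: pi_in; rewrite in_itv /= ler01 lexx.
have [|/(cell_carrier sK)//|[q]] := pi'E r; first by rewrite in_itv /= r0.
by rewrite in_itv /= => /andP[q0 q1] ->; apply: pi_in; rewrite in_itv /= q0 ltW.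
Qed.

Lemma sat_cell phi s x y :
  s \in simplexes (complex P) -> cell s x -> cell s y ->
  sat P phi x -> sat P phi y.
Proof.
elim: phi s x y => /= [p|phi IH|phi IH1 psi IH2|phi IH1 psi IH2] s x y sK sx sy.
- have [C [CK ->]] := valuation_cells P p; move=> [t Ct tx].
  by exists t => //; rewrite -(cell_disjoint sK (CK _ Ct) sx tx).
- by move=> nx py; apply: nx; exact: (IH _ _ _ sK sy sx).
- by move=> [px qx]; split;
    [exact: (IH1 _ _ _ sK sx sy) | exact: (IH2 _ _ _ sK sx sy)].
- move=> [pi [xpi pi1 pir]].
  have [pi' [ypi' pi'1 pi'r]] := path_prepend_cell sK sx sy xpi.
  exists pi'; split => //; first by rewrite pi'1.
  move=> r /pi'r[sr|[q q01 ->]]; last exact: pir.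
  have [_ _ pi0] := xpi.
  (* Time 0 lies in the half-open interval, so [phi] holds at [x] itself, and induction spreads it
     over the cell. *)
  apply: (IH1 _ _ _ sK sx sr); rewrite -pi0; apply: pir.
  by rewrite in_itv /= lexx ltr01.
Qed.

Lemma finite_eta_classes : exists L : seq 'rV[R]_m, forall x, carrier P x ->
  exists2 y, y \in L & eta_equivalent P x y.
Proof.
(* One representative per cell; the default [0] is never taken for the cell of [x]. *)
exists [seq xget 0 (cell s) | s <- simplexes (complex P)] => x.
move=> /polyhedron_cell[s sK sx].
exists (xget 0 (cell s)); first exact: map_f.
have sy : cell s (xget 0 (cell s)) by exact: xgetI sx.
by move=> phi; split; exact: sat_cell sK _ _.
Qed.

Lemma big_conj (T : eqType) (phi0 : formula PL) (f : T -> formula PL)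
    (I : seq T) :
  exists phi, forall x, sat P phi x <-> {in I, forall i, sat P (f i) x}.
Proof.
elim: I => [|i I [phi phiP]].
  (* The grammar has no constant for truth, so the empty conjunction is built from [phi0]. *)
  exists (Neg (Conj phi0 (Neg phi0))) => x; split => // _ /=.
  by case.
exists (Conj (f i) phi) => x /=; split.
  by move=> [fi /phiP fI] j; rewrite inE => /predU1P[->//|/fI].
move=> fI; split; first by apply: fI; rewrite inE eqxx.
by apply/phiP => j jI; apply: fI; rewrite inE jI orbT.
Qed.

(** [Q] is the disjunction, over representatives [a] in [Q], of the conjunction of formulas
    separating [a] from each representative outside [Q]. *)
Lemma eta_invariant_definable (phi0 : formula PL) (Q : set 'rV[R]_m) :
  (forall x y, eta_equivalent P x y -> Q x -> Q y) ->
  exists phi, forall x, carrier P x -> sat P phi x <-> Q x.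
Proof.
move=> Qinv; have [L LP] := finite_eta_classes.
have sep a b : exists phi, Q a -> ~ Q b -> sat P phi a /\ ~ sat P phi b.
  have [[Qa nQb]|nQ] := pselect (Q a /\ ~ Q b); last first.
    by exists phi0 => Qa nQb; case: nQ.
  have : ~ eta_equivalent P a b by move=> /Qinv /(_ Qa).
  move=> /existsNP[phi nphi].
  have [pa|na] := pselect (sat P phi a); have [pb|nb] := pselect (sat P phi b).
  - by case: nphi.
  - by exists phi.
  (* A distinguishing formula may hold at [b] instead of [a]; its negation then separates them. *)
  - by exists (Neg phi) => _ _; split => //=; exact.
  - by case: nphi.
have /choice[d dP] : forall a, exists d : 'rV[R]_m -> formula PL,
    forall b, Q a -> ~ Q b -> sat P (d b) a /\ ~ sat P (d b) b.
  by move=> a; have [d dP] := choice (sep a); exists d.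
have /choice[c cP] a : exists c, forall x,
    sat P c x <-> {in [seq b <- L | ~~ `[< Q b >]], forall b, sat P (d a b) x}.
  exact: big_conj.
(* By De Morgan, [Neg phi] is the disjunction of the [c a]. *)
have [phi phiP] := big_conj phi0 (fun a => Neg (c a)) [seq a <- L | `[< Q a >]].
exists (Neg phi) => x Px /=; have [y yL xy] := LP x Px.
have yx : eta_equivalent P y x by move=> psi; have [] := xy psi.
split.
  apply: contra_notP => nQx; apply/phiP => a; rewrite mem_filter.
  move=> /andP[/asboolP Qa aL] /= /cP cax.
  have nQy : ~ Q y by move/(Qinv _ _ yx).
  have [_ ndy] := dP a y Qa nQy; apply: ndy.
  apply/(xy (d a y)); apply: cax.
  by rewrite mem_filter yL andbT; apply/asboolPn.
move=> /(Qinv _ _ xy) Qy /phiP /(_ y).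
rewrite mem_filter yL andbT /= => /(_ (asboolT Qy)); apply.
apply/(xy (c y)); apply/cP => b; rewrite mem_filter => /andP[/asboolPn nQb _].
by have [] := dP y b Qy nQb.
Qed.

(** Symmetry of [Z] handles negation. For [Eta], each point of the answering path before its end is
    related to such a point of the given path, which transfers the first argument. *)
Lemma bisimulation_sat (Z : 'rV[R]_m -> 'rV[R]_m -> Prop) phi x y :
  weak_simplicial_bisimulation P Z -> Z x y -> sat P phi x -> sat P phi y.
Proof.
move=> [_ Zsym Zb]; elim: phi x y
  => /= [p|phi IH|phi IH1 psi IH2|phi IH1 psi IH2] x y Zxy.
- have [/(congr1 (fun A : set PL => A p)) /= -> _] := Zb _ _ Zxy.
  exact.
- by move=> nx py; apply: nx; exact: (IH _ _ (Zsym _ _ Zxy)).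
- by move=> [px qx]; split; [exact: (IH1 _ _ Zxy) | exact: (IH2 _ _ Zxy)].
- move=> [pi [xpi pi1 pir]]; have [_ /(_ pi xpi)] := Zb _ _ Zxy.
  move=> [pi' [ypi' Z1 Zr]]; exists pi'; split => //; first exact: (IH2 _ _ Z1).
  by move=> r /Zr[q /pir piq Zq]; exact: (IH1 _ _ Zq).
Qed.

Lemma eta_equivalent_bisimulation :
  weak_simplicial_bisimulation P
    (fun x y => [/\ carrier P x, carrier P y & eta_equivalent P x y]).
Proof.
have c1 : (1 : R) \in `[0, 1] by rewrite in_itv /= ler01 lexx.
have c0 : (0 : R) \in `[0, 1[ by rewrite in_itv /= lexx ltr01.
have cc (r : R) : r \in `[0, 1[ -> r \in `[0, 1].
  by rewrite !in_itv /= => /andP[-> /ltW].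
split=> [x y []//|x y [Px Py xy]|x y [Px Py xy]].
  by split=> // phi; have [] := xy phi.
split=> [|pi [cpi pi_in pi0]].
  by apply/seteqP; split=> p /=; have [] := xy (Prop_letter p).
(* There is no formula at all when [PL] is empty. *)
have [[phi0]|noform] := pselect (inhabited (formula PL)); last first.
  have eqv a b : eta_equivalent P a b by move=> phi; case: noform.
  exists (fun=> y); split => [||r _].
  - by split=> // r; exact: cvg_cst.
  - by split => //; exact: pi_in.
  - by exists 0 => //; split => //; exact: pi_in (cc _ _).
have [phi phiP] : exists phi, forall z, carrier P z ->
    sat P phi z <-> exists2 r, r \in `[0, 1[ & eta_equivalent P (pi r) z.
  apply: (eta_invariant_definable phi0) => a b ab [r r01 ra]; exists r => //.
  by move=> psi; rewrite (ra psi); exact: ab.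
have [psi psiP] : exists psi, forall z, carrier P z ->
    sat P psi z <-> eta_equivalent P (pi 1) z.
  apply: (eta_invariant_definable phi0) => a b ab pia.
  by move=> chi; rewrite (pia chi); exact: ab.
have : sat P (Eta phi psi) x.
  exists pi; split => [//||r r01]; first by apply/psiP => //; exact: pi_in.
  by apply/phiP; [exact: pi_in (cc _ _) | exists r].
move=> /(xy (Eta phi psi))[pi' [[cpi' pi'_in pi'0] pi'1 pi'r]].
exists pi'; split=> [//||r r01].
  by split; [exact: pi_in | exact: pi'_in | apply/psiP => //; exact: pi'_in].
(* Since [phi] holds at [pi' r], its class is met by [pi] at some time [q] before the end. *)
have [|q q01 e] := (phiP _ _).1 (pi'r r r01); first exact: pi'_in (cc _ r01).
by exists q => //; split=> //; [exact: pi_in (cc _ _) | exact: pi'_in (cc _ _)].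
Qed.

End Logic.

Theorem theorem4p9 (R : realType) (m : nat) (PL : Type)
    (P : polyhedral_model R m PL) (x1 x2 : 'rV[R]_m)
    (hx1 : carrier P x1) (hx2 : carrier P x2) :
  eta_equivalent P x1 x2 <-> weakly_simplicial_bisimilar P x1 x2.
Proof.
split=> [eqv|[Z [bisimZ Zx]] phi].
  by exists (fun x y => [/\ carrier P x, carrier P y & eta_equivalent P x y]);
    split=> //; exact: eta_equivalent_bisimulation.
have [_ Zsym _] := bisimZ.
by split; apply: (bisimulation_sat bisimZ) => //; exact: Zsym.
Qed.
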